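(* Let $(S,\rho)$ be a separable compact metric space with $\mathrm{diam}(S)>0$, let $S^\infty$ be the set of finite subsets of $S$, and let $d_0:S^\infty\times S^\infty\to[0,1]$ be a function such that, for all $x,y,z\in S^\infty$: 1. $\#x=\#y$ implies $d_0(x,y)=0$; 2. $d_0(x,y)=d_0(y,x)$; 3. $d_0(x,z)\le d_0(x,y)+d_0(y,z)$; 4. for every $x\in S^\infty$ there exists $\epsilon_0=\epsilon_0(x)>0$ such that $d_0(x,y)<\epsilon_0$ implies $\#x=\#y$. Define $d(x,y)=\frac1{\mathrm{diam}(S)}d_H(x,y)+d_0(x,y)$ for $x,y\in S^\infty$, where $d_H$ is the Hausdorff distance. Then the space $(S^\infty,d)$ is separable.
   Context: $S^\infty=\{x\subset S:\#x<\infty\}$; $\mathrm{diam}(S)=\sup_{x,y\in S}\rho(x,y)$. The Hausdorff distance is $d_H(A,C)=\max\{\sup_{a\in A}d(a,C),\sup_{c\in C}d(c,A)\}$ with $d(a,C)=\inf\{\rho(a,c):c\in C\}$; convention: $d_H(\emptyset,\emptyset)=0$ and $d_H(\emptyset,x)=+\infty$ for $x\ne\emptyset$ (so that $d_H$ and $d$ are extended metrics). *)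

(* Defs.v *)
From HB Require Import structures.
From mathcomp Require Import all_boot all_order all_algebra finmap.
From mathcomp Require Import all_classical all_reals all_analysis.

Set Implicit Arguments.
Unset Strict Implicit.
Unset Printing Implicit Defensive.

Import Order.TTheory GRing.Theory Num.Theory.

Local Open Scope classical_set_scope.
Local Open Scope ring_scope.
Local Open Scope ereal_scope.

Definition separable_space (T : topologicalType) : Prop :=
  exists2 D : set T, countable D & dense D.

Section metric_notions.
Context {R : realType} {S : metricType R}.
Implicit Types (a b : S) (x y : {fset S}).

Definition diam (A : set S) : \bar R :=
  ereal_sup [set (mdist a b)%:E | a in A & b in A].

(* [ereal_inf set0] is [+oo], so that [point_dist a fset0 = +oo]. *)
Definition point_dist a y : \bar R :=
  ereal_inf [set (mdist a b)%:E | b in [set` y]].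

(* The case distinction is needed because [ereal_sup set0] is [-oo]; when
   exactly one argument is empty the maximum is already [+oo], see below. *)
Definition hausdorff_dist x y : \bar R :=
  if (x == fset0) && (y == fset0) then 0
  else maxe (ereal_sup [set point_dist a y | a in [set` x]])
            (ereal_sup [set point_dist b x | b in [set` y]]).

Lemma hausdorff_dist00 : hausdorff_dist fset0 fset0 = 0.
Proof. by rewrite /hausdorff_dist eqxx. Qed.

Lemma hausdorff_distC x y : hausdorff_dist x y = hausdorff_dist y x.
Proof. by rewrite /hausdorff_dist andbC maxC. Qed.

Lemma hausdorff_dist0x x : x != fset0 -> hausdorff_dist fset0 x = +oo.
Proof.
move=> x0; rewrite /hausdorff_dist (negbTE x0) andbF.
have /fset0Pn[b bx] := x0.
apply/eqP; rewrite -leye_eq le_max; apply/orP; right.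
apply: ereal_sup_ubound; exists b => //.
rewrite /point_dist; apply/eqP; rewrite -leye_eq.
by apply: le_ereal_inf_tmp => u [c]; rewrite /= in_fset0.
Qed.

End metric_notions.

(* The space [(T, d)] for an extended metric [d]: a copy of [T] carrying the
   topology whose open sets are those containing a [d]-ball around each of
   their points. This is a topology for an arbitrary function [d]. *)
Definition emetric_space (R : realType) (T : choiceType) (d : T -> T -> \bar R)
  : Type := T.

Section emetric_topology.
Context {R : realType} {T : choiceType} (d : T -> T -> \bar R).

Definition eball (x : T) (e : R) : set T := [set y | d x y < e%:E].

Definition emetric_open (U : set T) : Prop :=
  forall x, U x -> exists2 e : R, (0 < e)%R & eball x e `<=` U.

Let emetric_openT : emetric_open setT.
Proof. by move=> x _; exists 1%R. Qed.

Let emetric_openI (A B : set T) :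
  emetric_open A -> emetric_open B -> emetric_open (A `&` B).
Proof.
move=> oA oB x [/oA[e e0 eA] /oB[f f0 fB]].
exists (Num.min e f); first by rewrite lt_min e0.
move=> y; rewrite /eball /= EFin_min lt_min => /andP[xye xyf].
by split; [exact: eA|exact: fB].
Qed.

Let emetric_open_bigU (I : Type) (f : I -> set T) :
  (forall i, emetric_open (f i)) -> emetric_open (\bigcup_i f i).
Proof.
move=> fo x [i _ /fo[e e0 ef]]; exists e => // y /ef fiy.
by exists i.
Qed.

HB.instance Definition _ := Choice.on (emetric_space d).
HB.instance Definition _ := isOpenTopological.Build (emetric_space d)
  emetric_openT emetric_openI emetric_open_bigU.

Lemma open_emetric : @open (emetric_space d) = emetric_open.
Proof. by []. Qed.

End emetric_topology.

(* Main.v *)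
(* If [D] is countable and dense in [S], the finite subsets of [D] are countable.
   A finite set [x] is approximated in the Hausdorff distance by finite subsets
   of [D] with as many points as [x], for which the term [d0] vanishes. *)

Require Import Defs.
From HB Require Import structures.
From mathcomp Require Import all_boot all_order all_algebra finmap.
From mathcomp Require Import all_classical all_reals all_analysis.

Import Order.TTheory GRing.Theory Num.Theory.

Local Open Scope classical_set_scope.
Local Open Scope fset_scope.
Local Open Scope ring_scope.
Local Open Scope ereal_scope.

(** The gap is a minimum of finitely many positive distances, capped by [1] so that it stays
    positive when [x] has no two distinct points. *)
Lemma fset_min_gap (R : realType) (S : metricType R) (x : {fset S}) :
  exists2 r : R, (0 < r)%R &
    {in x &, forall a b : S, (mdist a b < r)%R -> a = b}.
Proof.
pose pairs := [seq (a, b) | a <- enum_fset x, b <- enum_fset x].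
exists (\big[Num.min/1%R]_(p <- pairs | p.1 != p.2) mdist p.1 p.2).
  by apply: lt_bigmin => // p; rewrite mdist_gt0.
move=> a b ax bx; apply: contraTeq => ab; rewrite -leNgt.
apply: (@bigmin_inf_seq _ _ _ _ _ (a, b)) => //.
by apply/allpairsP; exists (a, b).
Qed.

(** Each [a] is paired with [f a], and every point of the image arises so; these pairs bound both
    suprema. *)
Lemma hausdorff_dist_imfset (R : realType) (S : metricType R) (x : {fset S})
    (f : S -> S) (e : R) : (0 <= e)%R ->
  {in x, forall a, (mdist a (f a) <= e)%R} ->
  hausdorff_dist x (f @` x)%fset <= e%:E.
Proof.
(* Two empty sets are at distance [0], which is where [0 <= e] enters. *)
move=> e0 fe; rewrite /hausdorff_dist; case: ifP => _; first by rewrite lee_fin.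
rewrite ge_max; apply/andP; split; apply: ge_ereal_sup => _ [a /= ax <-].
  apply: ge_ereal_inf; exists (mdist a (f a))%:E; last by rewrite lee_fin fe.
  by exists (f a) => //=; rewrite in_imfset.
have [b /= bx ->] := imfsetP _ _ _ _ ax.
apply: ge_ereal_inf; exists (mdist (f b) b)%:E; first by exists b.
by rewrite lee_fin metric_sym fe.
Qed.

Lemma dense_mdist (R : realType) (S : metricType R) (D : set S) (a : S)
  (e : R) : dense D -> (0 < e)%R -> exists2 b, D b & (mdist a b < e)%R.
Proof.
(* Density concerns open sets, so it is applied to the interior of the ball, which contains [a]. *)
move=> dD e0; have [||b []] := dD (ball a e)°.
- exists a; exact: nbhsx_ballx.
- exact: open_interior.
- by move=> /interior_subset; rewrite ballEmdist => ab Db; exists b.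
Qed.

(* Moving each point of [x] by less than half of the least distance between two
   of them keeps the points distinct, hence preserves the cardinality. *)
Lemma dense_fset_approx (R : realType) (S : metricType R) (D : set S)
    (x : {fset S}) (e : R) : dense D -> (0 < e)%R ->
  exists y : {fset S}, [/\ ([set` y] `<=` D)%classic, #|` y| = #|` x| &
    hausdorff_dist x y <= e%:E].
Proof.
move=> dD e0; have [r r0 xr] := fset_min_gap _ _ x.
have m0 : (0 < Num.min e (r / 2))%R by rewrite lt_min e0 divr_gt0.
have /choice[f fP] : forall a, exists b,
    D b /\ (mdist a b < Num.min e (r / 2))%R.
  by move=> a; have [b Db ab] := dense_mdist _ _ _ a _ dD m0; exists b.
exists (f @` x)%fset; split.
- by move=> _ /= /imfsetP[a _ ->]; have [] := fP a.
- apply/eqP/card_in_imfsetP => a b ax bx fab; apply: xr => //.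
  have [_] := fP a; have [_] := fP b; rewrite !lt_min => /andP[_ bf] /andP[_ af].
  rewrite (le_lt_trans (metric_triangle a (f a) b))// [ltRHS]splitr ltrD//.
  by rewrite fab metric_sym.
- apply: hausdorff_dist_imfset => [|a _]; first exact: ltW.
  by have [_] := fP a; rewrite lt_min => /andP[/ltW].
Qed.

Theorem proposition3 (R : realType) (S : metricType R)
  (S_separable : separable_space S)
  (S_compact : compact [set: S])
  (S_diam : 0 < diam [set: S])
  (d0 : {fset S} -> {fset S} -> R)
  (d0_range : forall x y, (0 <= d0 x y <= 1)%R)
  (d0_card : forall x y, #|` x| = #|` y| -> d0 x y = 0%R)
  (d0_sym : forall x y, d0 x y = d0 y x)
  (d0_triangle : forall x y z, (d0 x z <= d0 x y + d0 y z)%R)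
  (d0_sep : forall x, exists2 e0 : R, (0 < e0)%R &
     forall y, (d0 x y < e0)%R -> #|` x| = #|` y|) :
  separable_space (emetric_space (fun x y : {fset S} =>
    (diam [set: S])^-1 * hausdorff_dist x y + (d0 x y)%:E)).
Proof.
have [D cD dD] := S_separable.
(* If [S] were empty, its diameter would be the supremum of the empty set, [-oo]. The point [p]
   turns [S] into the pointed type used for the countability of the finite subsets of [D]. *)
have [p _] : [set: S] !=set0.
  apply/set0P/eqP => S0; move: S_diam; rewrite /diam S0.
  by rewrite image2E setX0 image_set0 ereal_sup0.
pose pS : pointedType := HB.pack (Choice.sort S) (isPointed.Build S p).
exists [set y : {fset S} | {subset y <= D}].
  exact: (@fset_subset_countable pS).
move=> U [x Ux]; rewrite open_emetric => /(_ x Ux)[e e0 xeU].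
(* The inverse is [+oo] only at [0], which [S_diam] excludes. *)
have [c c0 cE] : exists2 c : R, (0 <= c)%R & (diam [set: S])^-1 = c%:E.
  exists (fine (diam [set: S])^-1); rewrite ?fine_ge0 ?inve_ge0 ?ltW//.
  by rewrite fineK// ge0_fin_numE ?inve_ge0 ?ltW// ltey inve_eqy gt_eqF.
(* Approximating within [e / (c + 1)] gives [c * (e / (c + 1)) < e], strictly and without dividing
   by [c]. *)
have c1 : (0 < c + 1)%R by rewrite ltr_wpDl.
have [y [yD yx xy]] := dense_fset_approx _ _ _ x _ dD (divr_gt0 e0 c1).
exists y; split; last by move=> a /yD /mem_set.
apply: xeU; rewrite /eball /= d0_card// adde0.
apply: (le_lt_trans (lee_wpmul2l _ xy)); rewrite cE ?lee_fin//.
by rewrite -EFinM lte_fin mulrCA gtr_pMr// ltr_pdivrMr// mul1r ltrDl.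
Qed.
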